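(* Let $O\subseteq\mathbb{R}^2$ be a connected open set, with $D=\{x:(x,y)\in O\text{ for some }y\}$ and $I=\{y:(x,y)\in O\text{ for some }x\}$. Then: (1) $\mathrm{jsemi}(\mathrm{moves}_+(O))=\mathrm{moves}_+\bigl((D\cup I)\times(D\cup I)\bigr)$. (2a) If $D\cap I=\emptyset$, then $\mathrm{jsemi}(\mathrm{moves}_-(O))=\mathrm{moves}_-\bigl((D\times I)\cup(I\times D)\bigr)\cup\mathrm{moves}_+\bigl((D\times D)\cup(I\times I)\bigr)$. (2b) If $D\cap I\ne\emptyset$, then $\mathrm{jsemi}(\mathrm{moves}_-(O))=\mathrm{moves}\bigl((D\cup I)\times(D\cup I)\bigr)$. (3) $\mathrm{jsemi}(\mathrm{moves}(O))=\mathrm{moves}\bigl((D\cup I)\times(D\cup I)\bigr)$.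
   Context: For $t,r\in\mathbb{R}$ let $\tau_t(x)=x+t$ (translation) and $\rho_r(x)=r-x$ (reflection), as bijections of $\mathbb{R}$. A move $\gamma|_D$ is the restriction of a translation or reflection $\gamma$ to a set $D\subseteq\mathbb{R}$ that is an open interval or empty, viewed as a partial bijection $D\to\gamma(D)$. Moves with nonempty domain are equal iff both $\gamma$ and $D$ agree; all empty translations are identified to one object $\tau|_\emptyset$, all empty reflections to one object $\rho|_\emptyset\neq\tau|_\emptyset$. Composition: $\gamma_2|_{D_2}\circ\gamma_1|_{D_1}=(\gamma_2\circ\gamma_1)|_{D_1\cap\gamma_1^{-1}(D_2)}$; inverse: $(\gamma|_D)^{-1}=\gamma^{-1}|_{\gamma(D)}$ (in the composition of empty moves, the type, translation or reflection, is determined by multiplying characters $\chi=+1$ for translations, $-1$ for reflections). A move ensemble is a set of moves. $\mathrm{isemi}(\Omega)$ is the smallest move ensemble containing $\Omega$ and closed under composition and inverse. $\mathrm{join}(\Omega)$ is the smallest ensemble containing $\Omega$ that satisfies (restrict): if $\gamma|_D$ is in it and $D'\subseteq D$ is an open interval or empty, then $\gamma|_{D'}$ is in it; and (continuation): if $\gamma|_I$ is in it for all $I$ in a family whose union $D$ is an interval, then $\gamma|_D$ is in it. $\mathrm{jsemi}(\Omega)=\mathrm{join}(\mathrm{isemi}(\Omega))$. For $O\subseteq\mathbb{R}^2$, $\mathrm{moves}_+(O)$ (resp. $\mathrm{moves}_-(O)$) is the set of translation (resp. reflection) moves $\gamma|_D$, $D$ an open interval or empty, with graph $\{(x,\gamma(x)):x\in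 D\}\subseteq O$; $\mathrm{moves}(O)=\mathrm{moves}_+(O)\cup\mathrm{moves}_-(O)$. (For open $O$, the sets $D$ and $I$ of the claim are the unions of the domains, resp. images, of the moves in $\mathrm{moves}(O)$.) *)

(* Defs.v *)
From HB Require Import structures.
From mathcomp Require Import all_boot all_order all_algebra.
From mathcomp Require Import all_classical all_reals all_analysis.
From mathcomp Require Import ring lra.

Set Implicit Arguments.
Unset Strict Implicit.
Unset Printing Implicit Defensive.

Import Order.TTheory GRing.Theory Num.Theory.
Import numFieldNormedType.Exports.

Local Open Scope classical_set_scope.
Local Open Scope ring_scope.

Section Isometries.
Variable R : realType.

Inductive isometry : Type :=
| Translation of R
| Reflection of R.

Definition isom_act (g : isometry) (x : R) : R :=
  match g with
  | Translation t => x + t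
  | Reflection r => r - x
  end.

(* The character: [true] stands for +1 (translations), [false] for -1. *)
Definition is_translation (g : isometry) : bool :=
  match g with
  | Translation _ => true
  | Reflection _ => false
  end.

(* [isom_comp g2 g1] is g2 o g1, see [isom_compE]. *)
Definition isom_comp (g2 g1 : isometry) : isometry :=
  match g2, g1 with
  | Translation t, Translation s => Translation (s + t)
  | Translation t, Reflection r => Reflection (r + t)
  | Reflection r, Translation t => Reflection (r - t)
  | Reflection r, Reflection s => Translation (r - s)
  end.

Definition isom_inv (g : isometry) : isometry :=
  match g with
  | Translation t => Translation (- t)
  | Reflection r => Reflection r
  end.

Lemma isom_compE g2 g1 : isom_act (isom_comp g2 g1) = isom_act g2 \o isom_act g1.
Proof. by apply/funext => x; case: g2 g1 => ? [] ? /=; ring. Qed.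

Lemma is_translation_comp g2 g1 :
  is_translation (isom_comp g2 g1) = (is_translation g2 == is_translation g1).
Proof. by case: g2 g1 => ? []. Qed.

Lemma isom_actK g : cancel (isom_act g) (isom_act (isom_inv g)).
Proof. by move=> x; case: g => ? /=; ring. Qed.

Lemma isom_actVK g : cancel (isom_act (isom_inv g)) (isom_act g).
Proof. by move=> x; case: g => ? /=; ring. Qed.

Lemma isom_act_continuous g : continuous (isom_act g).
Proof.
move=> x; case: g => t /=.
  by apply: cvgD; [exact: cvg_id|exact: cvg_cst].
by apply: cvgB; [exact: cvg_cst|exact: cvg_id].
Qed.

End Isometries.

Section Domains.
Variable R : realType.

(* Open intervals, bounded or not, together with the empty set. *)
Record domain : Type := Domain {
  dom_set :> set R;
  dom_open : open dom_set;
  dom_itv : is_interval dom_set }.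

Lemma domain_eq (D E : domain) : D = E :> set R -> D = E.
Proof.
case: D E => [D oD iD] [E oE iE] /= DE; rewrite -{}DE in oE iE *.
by rewrite (Prop_irrelevance oD oE) (Prop_irrelevance iD iE).
Qed.

Lemma dom_preimage_open (g : isometry R) (D : domain) :
  open (isom_act g @^-1` D).
Proof.
by apply: open_comp; [move=> x _; exact: isom_act_continuous|exact: dom_open].
Qed.

Lemma dom_preimage_itv (g : isometry R) (D : domain) :
  is_interval (isom_act g @^-1` D).
Proof.
move=> x y /= Dx Dy z /andP[xz zy].
case: g Dx Dy => t /= Dx Dy.
  by apply: (dom_itv Dx Dy); rewrite !lerD2r xz.
by apply: (dom_itv Dy Dx); rewrite !lerD2l !lerN2 zy.
Qed.

Definition dom_preimage (g : isometry R) (D : domain) : domain :=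
  Domain (@dom_preimage_open g D) (@dom_preimage_itv g D).

Lemma isom_imageE (g : isometry R) (A : set R) :
  isom_act g @` A = isom_act (isom_inv g) @^-1` A.
Proof.
apply/seteqP; split=> [_ [x Ax <-]/=|y /= Ay]; first by rewrite isom_actK.
by exists (isom_act (isom_inv g) y) => //; exact: isom_actVK.
Qed.

Lemma dom_image_open (g : isometry R) (D : domain) : open (isom_act g @` D).
Proof. by rewrite isom_imageE; exact: dom_preimage_open. Qed.

Lemma dom_image_itv (g : isometry R) (D : domain) :
  is_interval (isom_act g @` D).
Proof. by rewrite isom_imageE; exact: dom_preimage_itv. Qed.

Definition dom_image (g : isometry R) (D : domain) : domain :=
  Domain (@dom_image_open g D) (@dom_image_itv g D).

Lemma dom_inter_itv (D E : domain) : is_interval (D `&` E).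
Proof.
move=> x y [Dx Ex] [Dy Ey] z xzy.
by split; [exact: (dom_itv Dx Dy)|exact: (dom_itv Ex Ey)].
Qed.

Definition dom_inter (D E : domain) : domain :=
  Domain (openI (@dom_open D) (@dom_open E)) (@dom_inter_itv D E).

End Domains.

Section Moves.
Variable R : realType.

Definition isom_normal (g : isometry R) : isometry R :=
  if is_translation g then Translation 0 else Reflection 0.

(* To identify all empty translations, and all empty reflections, the
   parameter of a move with empty domain is required to be 0; see
   [restrict_eqP] for the resulting equality of moves. *)
Record move : Type := Move {
  move_isom : isometry R;
  move_dom : domain R;
  move_empty : move_dom = set0 :> set R -> move_isom = isom_normal move_isom }.

Lemma isom_normal_idem g : isom_normal (isom_normal g) = isom_normal g.
Proof. by case: g. Qed.

Lemma restrict_subproof (g : isometry R) (D : domain R) :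
  let h := if `[< D = set0 :> set R >] then isom_normal g else g in
  D = set0 :> set R -> h = isom_normal h.
Proof. by move=> /= D0; rewrite asboolT// isom_normal_idem. Qed.

(* The move g|_D. *)
Definition restrict (g : isometry R) (D : domain R) : move :=
  Move (@restrict_subproof g D).

Lemma move_eq (m n : move) :
  move_isom m = move_isom n -> move_dom m = move_dom n -> m = n.
Proof.
case: m n => [g D gD] [h E hE] /= gh DE; rewrite -{}gh -{}DE in hE *.
by rewrite (Prop_irrelevance gD hE).
Qed.

Lemma moveE (m : move) : m = restrict (move_isom m) (move_dom m).
Proof.
apply: move_eq => //=; case: asboolP => // m0.
by rewrite -(move_empty m0).
Qed.

Lemma restrict_eqP (g h : isometry R) (D E : domain R) :
  restrict g D = restrict h E <->
  D = E :> set R /\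
  (if `[< D = set0 :> set R >] then is_translation g = is_translation h
   else g = h).
Proof.
split=> [[+ DE]|[/domain_eq <- gh]].
  rewrite -DE; split => //.
  by move: H; case: asboolP => // _; case: g h {DE} => ? [].
apply: move_eq => //=; move: gh; case: asboolP => // _.
by rewrite /isom_normal => ->.
Qed.

Definition move_comp (m2 m1 : move) : move :=
  restrict (isom_comp (move_isom m2) (move_isom m1))
    (dom_inter (move_dom m1) (dom_preimage (move_isom m1) (move_dom m2))).

Definition move_inv (m : move) : move :=
  restrict (isom_inv (move_isom m)) (dom_image (move_isom m) (move_dom m)).

Definition move_graph (m : move) : set (R * R) :=
  [set p | dom_set (move_dom m) p.1 /\ p.2 = isom_act (move_isom m) p.1].

End Moves.

Section Ensembles.
Variable R : realType.

(* A move ensemble is a [set (move R)]. *)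

Definition semigroup_closed (S : set (move R)) : Prop :=
  (forall m2 m1, S m2 -> S m1 -> S (move_comp m2 m1)) /\
  (forall m, S m -> S (move_inv m)).

Definition restrict_closed (S : set (move R)) : Prop :=
  forall (g : isometry R) (D D' : domain R),
    D' `<=` D -> S (restrict g D) -> S (restrict g D').

(* The union [D] is a nonempty interval: otherwise the empty family would
   put both empty moves into every closed ensemble.  For a nonempty family
   with empty union the condition is void. *)
Definition continuation_closed (S : set (move R)) : Prop :=
  forall (g : isometry R) (F : set (domain R)) (D : domain R),
    D !=set0 -> D = \bigcup_(I in F) I :> set R ->
    (forall I, F I -> S (restrict g I)) -> S (restrict g D).

Definition isemi (Omega : set (move R)) : set (move R) :=
  smallest semigroup_closed Omega.

Definition join (Omega : set (move R)) : set (move R) :=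
  smallest [set S | restrict_closed S /\ continuation_closed S] Omega.

Definition jsemi (Omega : set (move R)) : set (move R) := join (isemi Omega).

Definition moves_plus (O : set (R * R)) : set (move R) :=
  [set m | is_translation (move_isom m) /\ move_graph m `<=` O].

Definition moves_minus (O : set (R * R)) : set (move R) :=
  [set m | ~~ is_translation (move_isom m) /\ move_graph m `<=` O].

Definition moves (O : set (R * R)) : set (move R) :=
  moves_plus O `|` moves_minus O.

End Ensembles.

(* Main.v *)
(** For an open connected [O], say that [x] is linked to [y] when some move of
    the semigroup maps a neighbourhood of [x] to a neighbourhood of [y] and [x]
    to [y].  Links of both characters compose like a groupoid.  Near a point
    [(x, y)] of [O], [O] also contains [(x', y)], so going [x -> y -> x'] links
    [x] to every nearby [x'] by a translation: the class of [p.1] is locally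
    constant on [O], hence constant.  All links between points of [D] and [I]
    follow, and continuation glues the local moves into the maximal ones.
    Conversely the right-hand sides are closed because the sets that are to
    contain the graphs form groupoids themselves. *)
Require Import Defs.
From mathcomp Require Import all_boot all_order all_algebra.
From mathcomp Require Import all_classical all_reals all_analysis.
From mathcomp Require Import ring.
Import Order.TTheory GRing.Theory Num.Theory.
Import numFieldNormedType.Exports.
Import Defs.

Local Open Scope classical_set_scope.
Local Open Scope ring_scope.

Set Implicit Arguments.
Unset Strict Implicit.
Unset Printing Implicit Defensive.

Section Moves.
Variable R : realType.
Implicit Types (g h : isometry R) (J K : domain R) (m : move R).
Implicit Types (S Omega : set (move R)) (b c : bool) (x y z : R).

(** * Isometries through prescribed points, and links *)

Lemma is_translation_inv g : is_translation (isom_inv g) = is_translation g.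
Proof. by case: g. Qed.

Lemma is_translation_restrict g J :
  is_translation (move_isom (restrict g J)) = is_translation g.
Proof. by rewrite /=; case: asboolP => // _; case: g. Qed.

Lemma move_isom_restrict g J x : dom_set J x -> move_isom (restrict g J) = g.
Proof. by move=> Jx /=; case: asboolP => // J0; move: Jx; rewrite J0. Qed.

Lemma move_graph_restrict g J :
  move_graph (restrict g J) = [set p | dom_set J p.1 /\ p.2 = isom_act g p.1].
Proof.
by apply/seteqP; split=> -[x y] [Jx];
  rewrite /move_graph /= -/(move_isom (restrict g J)) (move_isom_restrict _ Jx).
Qed.

(** The unique isometry of character [b] taking [x] to [y]. In this form composition and inversion
    act on endpoints and characters alone. *)
Definition isom_between b x y : isometry R :=
  if b then Translation (y - x) else Reflection (x + y).

Lemma isom_between_act b x y : isom_act (isom_between b x y) x = y.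
Proof. by case: b => /=; ring. Qed.

Lemma is_translation_between b x y : is_translation (isom_between b x y) = b.
Proof. by case: b. Qed.

Lemma isom_betweenE g x :
  isom_between (is_translation g) x (isom_act g x) = g.
Proof. by case: g => t /=; congr (_ _); ring. Qed.

(** With [true] standing for +1, [c == b] is the product of the two characters. *)
Lemma isom_between_comp b c x y z :
  isom_comp (isom_between c y z) (isom_between b x y) =
  isom_between (c == b) x z.
Proof. by case: b c => -[] /=; congr (_ _); ring. Qed.

Lemma isom_between_inv b x y :
  isom_inv (isom_between b x y) = isom_between b y x.
Proof. by case: b => /=; congr (_ _); ring. Qed.

Definition link S b x y : Prop :=
  exists2 J, dom_set J x & S (restrict (isom_between b x y) J).

Lemma link_trans S b c x y z : semigroup_closed S ->
  link S b x y -> link S c y z -> link S (c == b) x z.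
Proof.
move=> [Scomp _] [J Jx SJ] [K Ky SK].
have := Scomp _ _ SK SJ; rewrite /move_comp.
rewrite (move_isom_restrict _ Jx) (move_isom_restrict _ Ky) isom_between_comp.
(* The point [x] survives in the domain of the composite because it is sent to [y], which lies in
   [K]. *)
by apply: ex_intro2; split; rewrite //= isom_between_act.
Qed.

Lemma link_sym S b x y : semigroup_closed S -> link S b x y -> link S b y x.
Proof.
move=> [_ Sinv] [J Jx SJ]; have := Sinv _ SJ.
rewrite /move_inv (move_isom_restrict _ Jx) isom_between_inv.
by apply: ex_intro2; exists x => //; exact: isom_between_act.
Qed.

(** A common form for all ensembles of the theorem: [T] lists the allowed characters, and the bound
    [P] on graphs may depend on the character, as the disjoint case requires. *)
Definition moves_of (T : set bool) (P : bool -> set (R * R)) : set (move R) :=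
  [set m | T (is_translation (move_isom m)) /\
           move_graph m `<=` P (is_translation (move_isom m))].

Lemma moves_of_restrict T P g J :
  moves_of T P (restrict g J) <->
  T (is_translation g) /\
  forall x, dom_set J x -> P (is_translation g) (x, isom_act g x).
Proof.
rewrite /moves_of /mkset is_translation_restrict move_graph_restrict.
split=> -[Tg gP]; split=> //; first by move=> x Jx; exact: gP.
by move=> [x y] [/= Jx ->]; exact: gP.
Qed.

Lemma moves_plusE (O : set (R * R)) :
  moves_plus O = moves_of [set true] (fun=> O).
Proof. by []. Qed.

Lemma moves_minusE (O : set (R * R)) :
  moves_minus O = moves_of [set false] (fun=> O).
Proof.
by apply/seteqP; split=> m [mb mO]; split=> //; [exact/negbTE|rewrite mb].
Qed.

Lemma moves_minusU_plus (P : bool -> set (R * R)) :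
  moves_minus (P false) `|` moves_plus (P true) = moves_of setT P.
Proof.
apply/seteqP; split=> m; rewrite /moves_minus /moves_plus /moves_of /=.
  by case=> -[]; case: is_translation.
by case: is_translation => -[_ mP]; [right|left].
Qed.

Lemma movesE (O : set (R * R)) : moves O = moves_of setT (fun=> O).
Proof. by rewrite /moves setUC (moves_minusU_plus (fun=> O)). Qed.

(** * Upper bounds for [jsemi] from groupoids graded by the character *)

Section Groupoid.
Variables (T : set bool) (P : bool -> set (R * R)).
Hypothesis T_comp : forall b c, T b -> T c -> T (c == b).
Hypothesis P_trans : forall b c x y z,
  P b (x, y) -> P c (y, z) -> P (c == b) (x, z).
Hypothesis P_sym : forall b x y, P b (x, y) -> P b (y, x).

Lemma moves_of_semigroup : semigroup_closed (moves_of T P).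
Proof.
split=> [m2 m1|m].
  rewrite (moveE m2) (moveE m1).
  move: (move_isom m2) (move_isom m1) (move_dom m2) (move_dom m1).
  move=> g2 g1 J2 J1 /moves_of_restrict[T2 P2] /moves_of_restrict[T1 P1].
  rewrite /move_comp; apply/moves_of_restrict; split.
    by rewrite is_translation_comp !is_translation_restrict; exact: T_comp.
  (* Simplification exposed the test for an empty domain; folding it back lets [move_isom_restrict]
     discard it. *)
  move=> x [/= J1x]; rewrite -!/(move_isom (restrict _ _)).
  rewrite (move_isom_restrict _ J1x) => J2x.
  rewrite (move_isom_restrict _ J2x) isom_compE is_translation_comp.
  by apply: P_trans; [exact: P1|exact: P2].
rewrite (moveE m); move: (move_isom m) (move_dom m) => g J.
move=> /moves_of_restrict[Tg Pg].
rewrite /move_inv; apply/moves_of_restrict; split.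
  by rewrite is_translation_inv is_translation_restrict.
move=> _ [x Jx <-]; rewrite isom_actK is_translation_inv.
by rewrite (move_isom_restrict _ Jx); exact/P_sym/Pg.
Qed.

Lemma moves_of_restrict_closed : restrict_closed (moves_of T P).
Proof.
move=> g J K KJ /moves_of_restrict[Tg Pg]; apply/moves_of_restrict.
by split=> // x /KJ; exact: Pg.
Qed.

Lemma moves_of_continuation_closed : continuation_closed (moves_of T P).
Proof.
move=> g F J [x Jx] JF FP; apply/moves_of_restrict; split.
  (* The character is read off a member of the family, which exists because the union is
     nonempty. *)
  by move: Jx; rewrite JF => -[K FK _]; have /moves_of_restrict[] := FP _ FK.
move=> {Jx}x; rewrite JF => -[K FK Kx].
by have /moves_of_restrict[_] := FP _ FK; exact.
Qed.

Lemma jsemi_sub_moves_of Omega :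
  Omega `<=` moves_of T P -> jsemi Omega `<=` moves_of T P.
Proof.
move=> OmegaP; apply: smallest_sub.
  split; [exact: moves_of_restrict_closed|exact: moves_of_continuation_closed].
by apply: smallest_sub => //; exact: moves_of_semigroup.
Qed.

End Groupoid.

(** * Lower bounds for [jsemi] by gluing local moves *)

Lemma isemi_semigroup Omega : semigroup_closed (isemi Omega).
Proof.
split=> [m2 m1 S2 S1|m Sm] S [Sc SO].
  by apply: Sc.1; [exact: S2|exact: S1].
by apply: Sc.2; exact: Sm.
Qed.

Lemma join_restrict Omega : restrict_closed (join Omega).
Proof.
by move=> g J K KJ SJ S [Sc SO]; apply: Sc.1 KJ _; exact: SJ.
Qed.

Lemma join_continuation Omega : continuation_closed (join Omega).
Proof.
by move=> g F J J0 JF SF S [Sc SO]; apply: Sc.2 J0 JF _ => K FK; exact: SF.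
Qed.

(** Links provide moves around each point of a nonempty domain, and continuation glues them. Empty
    moves contain no point to link, so the first hypothesis supplies them. *)
Lemma moves_of_sub_jsemi Omega T P :
  (forall b, T b ->
    exists2 m, isemi Omega m & is_translation (move_isom m) = b) ->
  (forall b x y, T b -> P b (x, y) -> link (isemi Omega) b x y) ->
  moves_of T P `<=` jsemi Omega.
Proof.
move=> Tm PL m; rewrite (moveE m); move: (move_isom m) (move_dom m) => g J.
move=> /moves_of_restrict[Tg Pg].
have [J0|/set0P J0] := eqVneq (dom_set J) set0.
  (* An empty move is determined by its character, hence is a restriction of [n]. *)
  have [n Sn ng] := Tm _ Tg.
  have -> : restrict g J = restrict (move_isom n) J.
    by apply/restrict_eqP; rewrite asboolT.
  apply: (@join_restrict _ _ (move_dom n)); first by rewrite J0.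
  by rewrite -moveE; exact: sub_gen_smallest.
pose F := [set K : domain R | K `<=` J /\ jsemi Omega (restrict g K)].
apply: (@join_continuation _ _ F J) => //; last by move=> K [].
apply/seteqP; split=> [x Jx|x [K [KJ _]]]; last exact: KJ.
have [K Kx SK] := PL _ _ _ Tg (Pg _ Jx).
(* A link from [x] to its image with the character of [g] is realised by [g] itself. *)
rewrite isom_betweenE in SK.
exists (dom_inter J K) => //; split; first by move=> z [].
apply: (@join_restrict _ _ K); first by move=> z [].
exact: sub_gen_smallest.
Qed.

(** * Links inside an open connected set *)

Lemma link_of_open Omega (O : set (R * R)) b x y : open O ->
  moves_of [set b] (fun=> O) `<=` isemi Omega -> O (x, y) ->
  link (isemi Omega) b x y.
Proof.
move=> oO OS Oxy; set g := isom_between b x y.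
have /nbhs_ballP[e /= e0 eO] : \forall z \near x, O (z, isom_act g z).
  have cg : (fun z => (z, isom_act g z)) @ x --> (x, isom_act g x).
    apply: (@cvg_pair _ _ _ _ (nbhs x) (nbhs (isom_act g x))).
      exact: cvg_id.
    exact: isom_act_continuous.
  by apply: cg; rewrite isom_between_act; exact: open_nbhs_nbhs.
have iB : is_interval (ball x e).
  by rewrite ball_itv; exact: interval_is_interval.
pose J := Domain (ball_open x e) iB.
exists J; first exact: ballxx.
apply: OS; apply/moves_of_restrict; split=> [|z]; last exact: eO.
exact: is_translation_between.
Qed.

(** The points of [A] related to [p] form a set that is both open and closed in [A], hence all of
    [A]. *)
Lemma connected_locally_related (U : topologicalType) (A : set U)
    (r : U -> U -> Prop) :
  open A -> connected A ->
  (forall p q, A p -> A q -> r p q -> r q p) ->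
  (forall p q s, r p q -> r q s -> r p s) ->
  (forall p, A p -> \forall q \near p, r p q) ->
  forall p q, A p -> A q -> r p q.
Proof.
move=> oA cA rC rT rloc p q Ap Aq.
have AN u : A u -> \forall v \near u, A v /\ r u v.
  move=> Au; near=> v; split; near: v; last exact: rloc.
  exact: open_nbhs_nbhs.
suff BA : A `&` [set u | r p u] = A by have : A q := Aq; rewrite -BA => -[].
apply: cA.
(* Reflexivity at [p] comes from the local hypothesis, since [p] lies in each of its
   neighbourhoods. *)
- by exists p; split=> //; have /nbhs_singleton[] := AN _ Ap.
- exists (A `&` [set u | r p u]); last by rewrite setIA setIid.
  rewrite openE => u [Au pu]; apply: filterS (AN _ Au) => v [Av uv].
  by split=> //; exact: rT uv.
- exists (~` (A `&` [set u | ~ r p u])).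
    apply: open_closedC; rewrite openE => u [Au pu].
    apply: filterS (AN _ Au) => v [Av uv]; split=> // pv; apply: pu.
    by apply: rT pv _; exact: rC.
  apply/seteqP; split=> u [Au]; first by move=> pu; split=> // -[].
  by move=> /= nu; split=> //; apply: contrapT => pu; exact: nu.
Unshelve. all: by end_near. Qed.

Section Links.
Variables (Omega : set (move R)) (O : set (R * R)) (b : bool).
Hypotheses (O_open : open O) (O_connected : connected O).
Hypothesis O_sub : moves_of [set b] (fun=> O) `<=` isemi Omega.

Let D := [set x : R | exists y : R, O (x, y)].
Let I := [set y : R | exists x : R, O (x, y)].
Let L := link (isemi Omega).

Let LT c d x y z (xy : L c x y) (yz : L d y z) : L (d == c) x z.
Proof. exact: link_trans (isemi_semigroup _) xy yz. Qed.

Let LS c x y (xy : L c x y) : L c y x.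
Proof. exact: link_sym (isemi_semigroup _) xy. Qed.

(** Two links of the same character [b] compose to a translation link, so one argument serves both
    values of [b]. *)
Lemma link_fst x x' : D x -> D x' -> link (isemi Omega) true x x'.
Proof.
move=> [y Oxy] [y' Oxy'].
apply: (@connected_locally_related _ O (fun p q => L true p.1 q.1)
  O_open O_connected _ _ _ (x, y) (x', y')) => //.
- by move=> p q _ _; exact: LS.
- by move=> p q s pq qs; exact: LT pq qs.
move=> [{Oxy Oxy'}x {}y] Oxy.
have cy : (fun q : R * R => (q.1, y)) @ (x, y) --> (x, y).
  apply: (@cvg_pair _ _ _ _ (nbhs x) (nbhs y)); first exact: cvg_fst.
  exact: cvg_cst.
have : \forall q \near (x, y), O (q.1, y).
  by apply: cy; exact: open_nbhs_nbhs.
apply: filterS => q Oqy /=.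
have Lxy : L b x y by exact: link_of_open Oxy.
have Lqy : L b q.1 y by exact: link_of_open Oqy.
by have := LT Lxy (LS Lqy); rewrite eqxx.
Qed.

(** Translate [x] to a point [a] with [(a, y)] in [O], then follow the link given by [O]. *)
Lemma link_fst_snd x y : D x -> I y -> link (isemi Omega) b x y.
Proof.
move=> Dx [a Oay]; have Lay : L b a y by exact: link_of_open Oay.
have Da : D a by exists y.
by have := LT (link_fst Dx Da) Lay; rewrite eqb_id.
Qed.

Lemma link_snd y y' : I y -> I y' -> link (isemi Omega) true y y'.
Proof.
move=> [x Oxy] Iy'; have Lxy : L b x y by exact: link_of_open Oxy.
have Dx : D x by exists y.
by have := LT (LS Lxy) (link_fst_snd Dx Iy'); rewrite eqxx.
Qed.

(** [D] and [I] are joined either through a common point or directly, when [O] itself gives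
    translation links. *)
Lemma link_union : (D `&` I !=set0 \/ b = true) ->
  forall x y, (D `|` I) x -> (D `|` I) y -> link (isemi Omega) true x y.
Proof.
move=> bDI.
have DI x y : D x -> I y -> L true x y.
  case: bDI => [[z [Dz Iz]]|bt] Dx Iy.
    exact: LT (link_fst Dx Dz) (link_snd Iz Iy).
  by have := link_fst_snd Dx Iy; rewrite bt.
move=> x y [Dx|Ix] [Dy|Iy].
- exact: link_fst.
- exact: DI.
- exact/LS/DI.
- exact: link_snd.
Qed.

End Links.

(** One point of [O] gives one reflection link; translation links on either side carry it to any
    pair of endpoints. *)
Lemma link_false_union Omega (O : set (R * R)) (A : set R) :
  open O -> moves_minus O `<=` isemi Omega ->
  (forall x y, O (x, y) -> A x /\ A y) -> O !=set0 ->
  (forall x y, A x -> A y -> link (isemi Omega) true x y) ->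
  forall x y, A x -> A y -> link (isemi Omega) false x y.
Proof.
rewrite moves_minusE => oO OS OA [[a c] Oac] AL x y Ax Ay.
have [Aa Ac] := OA _ _ Oac; have Sc := isemi_semigroup Omega.
have Lac : link (isemi Omega) false a c by exact: link_of_open Oac.
exact: link_trans (link_trans Sc (AL _ _ Ax Aa) Lac) (AL _ _ Ac Ay).
Qed.

(** An empty move meets every bound on graphs, so this covers even an empty [O]. *)
Lemma moves_of_inhabited (T : set bool) P b :
  T b -> exists2 m, moves_of T P m & is_translation (move_isom m) = b.
Proof.
move=> Tb.
pose J := Domain (@open0 R) (fun x y (Jx : set0 x) => False_ind _ Jx).
exists (restrict (isom_between b 0 0) J).
  by apply/moves_of_restrict; rewrite is_translation_between; split.
by rewrite is_translation_restrict is_translation_between.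
Qed.

End Moves.

Theorem corollary4p9 (R : realType) (O : set (R * R))
    (O_open : open O) (O_connected : connected O) :
  let D := [set x : R | exists y : R, O (x, y)] in
  let I := [set y : R | exists x : R, O (x, y)] in
  [/\ jsemi (moves_plus O) = moves_plus ((D `|` I) `*` (D `|` I)),
      D `&` I = set0 ->
        jsemi (moves_minus O) =
        moves_minus ((D `*` I) `|` (I `*` D)) `|`
        moves_plus ((D `*` D) `|` (I `*` I)),
      D `&` I !=set0 ->
        jsemi (moves_minus O) = moves ((D `|` I) `*` (D `|` I)) &
      jsemi (moves O) = moves ((D `|` I) `*` (D `|` I))].
Proof.
move=> D I; set A := D `|` I.
have OD x y : O (x, y) -> D x by exists y.
have OI x y : O (x, y) -> I y by exists x.
have OA x y : O (x, y) -> A x /\ A y.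
  by move=> Oxy; split; [left; exact: OD Oxy|right; exact: OI Oxy].
have A_O x : A x -> O !=set0 by case=> -[y Oxy]; eexists; exact: Oxy.
pose sqA (_ : bool) := A `*` A.
have sqA_trans b c x y z : sqA b (x, y) -> sqA c (y, z) -> sqA (c == b) (x, z).
  by case=> Ax _ [].
have sqA_sym b x y : sqA b (x, y) -> sqA b (y, x) by case.
have OsqA : O `<=` A `*` A by case=> x y /OA.
have minus_inh b : exists2 m, isemi (moves_minus O) m &
    is_translation (move_isom m) = b.
  have [m Om mf] : exists2 m, moves_minus O m &
      is_translation (move_isom m) = false.
    by rewrite moves_minusE; exact: moves_of_inhabited.
  have Sm : isemi (moves_minus O) m by exact: sub_gen_smallest.
  case: b; last by exists m.
  (* A reflection composed with itself has the character of a translation. *)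
  exists (move_comp m m); first exact: (isemi_semigroup _).1.
  by rewrite is_translation_restrict is_translation_comp eqxx.
have minus_sub : moves_of [set false] (fun=> O) `<=` isemi (moves_minus O).
  by rewrite -moves_minusE; exact: sub_gen_smallest.
split.
- rewrite !moves_plusE; apply/seteqP; split.
    apply: jsemi_sub_moves_of => //; first by move=> b c -> ->.
    by move=> m [mt mO]; split=> // p /mO; exact: OsqA.
  have Osub : moves_of [set true] (fun=> O) `<=`
      isemi (moves_of [set true] (fun=> O)) by exact: sub_gen_smallest.
  apply: moves_of_sub_jsemi => [b /= ->|b x y /= -> [Ax Ay]].
    have [m Om mt] := @moves_of_inhabited R [set true] (fun=> O) true erefl.
    by exists m => //; exact: Osub.
  by apply: link_union O_open O_connected Osub _ _ _ Ax Ay; right.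
- move=> DI0.
  pose P b := if b then (D `*` D) `|` (I `*` I) else (D `*` I) `|` (I `*` D).
  rewrite (moves_minusU_plus P); apply/seteqP; split.
    have nDI x : D x -> I x -> False.
      by move=> Dx Ix; have : (D `&` I) x by []; rewrite DI0.
    apply: jsemi_sub_moves_of => //.
    (* The middle point [y] cannot lie in both [D] and [I], so only matching blocks compose. *)
    + by case=> -[] x y z [] [/= ? ?] [] [/= ? ?];
        solve [by left|by right|exfalso; eauto].
    + by case=> x y [] [/= ? ?]; solve [by left|by right].
    rewrite moves_minusE => m [/= mf mO]; split=> //; rewrite mf.
    by case=> x y /mO Oxy; left; split; [exact: OD Oxy|exact: OI Oxy].
  apply: moves_of_sub_jsemi => // -[] x y _ /= [] [/= x_in y_in].
  + exact: link_fst O_open O_connected minus_sub _ _ x_in y_in.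
  + exact: link_snd O_open O_connected minus_sub _ _ x_in y_in.
  + exact: link_fst_snd O_open O_connected minus_sub _ _ x_in y_in.
  apply: link_sym; first exact: isemi_semigroup.
  exact: link_fst_snd O_open O_connected minus_sub _ _ y_in x_in.
- move=> DI; rewrite movesE; apply/seteqP; split.
    apply: jsemi_sub_moves_of => //.
    by move=> m [_ mO]; split=> // p /mO; exact: OsqA.
  have true_link x y : A x -> A y -> link (isemi (moves_minus O)) true x y.
    by apply: link_union O_open O_connected minus_sub _ _ _; left.
  apply: moves_of_sub_jsemi => // -[] x y _ [/= Ax Ay]; first exact: true_link.
  apply: (link_false_union O_open _ OA (A_O _ Ax) true_link) => //.
  exact: sub_gen_smallest.
- have moves_sub : moves O `<=` isemi (moves O) by exact: sub_gen_smallest.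
  have true_link x y : A x -> A y -> link (isemi (moves O)) true x y.
    (* The translations in [O] already link all of [A], whether or not [D] and [I] meet. *)
    apply: (@link_union _ _ O true) => //; last by right.
    by apply: subset_trans moves_sub => m; left.
  rewrite (movesE (A `*` A)); apply/seteqP; split.
    apply: jsemi_sub_moves_of => //; rewrite movesE.
    by move=> m [_ mO]; split=> // p /mO; exact: OsqA.
  apply: moves_of_sub_jsemi => [b _|].
    have [m Om mb] := @moves_of_inhabited R setT (fun=> O) b Logic.I.
    by exists m => //; apply: moves_sub; rewrite movesE.
  move=> -[] x y _ [/= Ax Ay]; first exact: true_link.
  apply: (link_false_union O_open _ OA (A_O _ Ax) true_link) => //.
  by apply: subset_trans moves_sub => m; right.
Qed.
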